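(* For all integers $m\ge 1$, $$\alpha_{1,m} = \begin{cases} 1, & \text{if } m \text{ is odd},\\[4pt] \dfrac m2, & \text{if } m \text{ is even}.\end{cases}$$
   Context: For integers $n,m\ge 1$, the grid $G(n,m)$ has cell set $V_{n,m}=\{(i,j): 1\le i\le n,\ 1\le j\le m\}$ ($i$ = row, $j$ = column). Contamination rules: a cell $u=(i,j)\in V_{n,m}$ can be contaminated by two contaminated cells $v,w\in V_{n,m}$ if one of the following holds: (a) $v=(i-1,j-1)$, $w=(i+1,j+1)$; (b) $v=(i+1,j-1)$, $w=(i-1,j+1)$; (c) $v=(i-1,j)$, $w=(i+1,j)$; (d) $v=(i,j-1)$, $w=(i,j+1)$; (e) $v=(i,j-1)$, $w=(i-1,j)$; (f) $v=(i,j-1)$, $w=(i+1,j)$; (g) $v=(i+1,j)$, $w=(i,j+1)$; (h) $v=(i-1,j)$, $w=(i,j+1)$. (When $n=1$ only rule (d) can apply.) For $S\subseteq V_{n,m}$, the final contaminated set $C(S)$ is the smallest subset of $V_{n,m}$ containing $S$ and closed under rules (a)--(h). $S$ is a contaminating set if $C(S)=V_{n,m}$. The power contamination number $\gamma_c(G(n,m))$ is the minimum cardinality of a contaminating set; a contaminating set of this cardinality is an optimal solution. $\alpha_{n,m}$ denotes the number of optimal solutions of $G(n,m)$. *)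

(* Defs.v *)
From mathcomp Require Import all_boot.

Set Implicit Arguments.
Unset Strict Implicit.
Unset Printing Implicit Defensive.

Section Grid.

Variables n m : nat.

(* The cell in row i and column j (1 <= i <= n, 1 <= j <= m) is the pair of
   ordinals (i - 1, j - 1); the rules only involve coordinate differences. *)
Local Notation cell := ('I_n * 'I_m)%type.

(* "a = b - 1" is written "a.+1 == b", so that truncated subtraction never
   occurs and no neighbour outside of the grid is created. *)
Definition rule_a (u v w : cell) : bool :=
  [&& v.1.+1 == u.1 :> nat, v.2.+1 == u.2 :> nat,
      w.1 == u.1.+1 :> nat & w.2 == u.2.+1 :> nat].

Definition rule_b (u v w : cell) : bool :=
  [&& v.1 == u.1.+1 :> nat, v.2.+1 == u.2 :> nat,
      w.1.+1 == u.1 :> nat & w.2 == u.2.+1 :> nat].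

Definition rule_c (u v w : cell) : bool :=
  [&& v.1.+1 == u.1 :> nat, v.2 == u.2 :> nat,
      w.1 == u.1.+1 :> nat & w.2 == u.2 :> nat].

Definition rule_d (u v w : cell) : bool :=
  [&& v.1 == u.1 :> nat, v.2.+1 == u.2 :> nat,
      w.1 == u.1 :> nat & w.2 == u.2.+1 :> nat].

Definition rule_e (u v w : cell) : bool :=
  [&& v.1 == u.1 :> nat, v.2.+1 == u.2 :> nat,
      w.1.+1 == u.1 :> nat & w.2 == u.2 :> nat].

Definition rule_f (u v w : cell) : bool :=
  [&& v.1 == u.1 :> nat, v.2.+1 == u.2 :> nat,
      w.1 == u.1.+1 :> nat & w.2 == u.2 :> nat].

Definition rule_g (u v w : cell) : bool :=
  [&& v.1 == u.1.+1 :> nat, v.2 == u.2 :> nat,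
      w.1 == u.1 :> nat & w.2 == u.2.+1 :> nat].

Definition rule_h (u v w : cell) : bool :=
  [&& v.1.+1 == u.1 :> nat, v.2 == u.2 :> nat,
      w.1 == u.1 :> nat & w.2 == u.2.+1 :> nat].

(* u can be contaminated by the contaminated cells v and w. *)
Definition contaminated_by (u v w : cell) : bool :=
  [|| rule_a u v w, rule_b u v w, rule_c u v w, rule_d u v w,
      rule_e u v w, rule_f u v w, rule_g u v w | rule_h u v w].

Definition rule_closed (A : {set cell}) : bool :=
  [forall u, forall v, forall w,
    [&& contaminated_by u v w, v \in A & w \in A] ==> (u \in A)].

Definition final_set (S : {set cell}) : {set cell} :=
  \bigcap_(A : {set cell} | (S \subset A) && rule_closed A) A.

Definition contaminating (S : {set cell}) : bool :=
  final_set S == [set: cell].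

(* The full set of cells is contaminating (see contaminating_setT), so this
   minimum is taken over a nonempty family (see gamma_cP). *)
Definition gamma_c : nat :=
  #|[arg min_(S < [set: cell] | contaminating S) #|S|]|.

Definition optimal (S : {set cell}) : bool :=
  contaminating S && (#|S| == gamma_c).

Definition alpha : nat := #|[set S : {set cell} | optimal S]|.

Lemma rule_closedP (A : {set cell}) :
  reflect (forall u v w, contaminated_by u v w -> v \in A -> w \in A -> u \in A)
          (rule_closed A).
Proof.
apply: (iffP forallP) => [clA u v w cu vA wA | clA u].
  by move/forallP/(_ v)/forallP/(_ w)/implyP: (clA u); apply; rewrite cu vA wA.
by apply/forallP => v; apply/forallP => w; apply/implyP => /and3P[]; apply: clA.
Qed.

Lemma sub_final_set (S : {set cell}) : S \subset final_set S.
Proof. by apply/bigcapsP => A /andP[]. Qed.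

Lemma final_set_closed (S : {set cell}) : rule_closed (final_set S).
Proof.
apply/rule_closedP => u v w cu /bigcapP vC /bigcapP wC.
apply/bigcapP => A PA; have /andP[_ /rule_closedP clA] := PA.
by apply: clA cu _ _; [apply: vC | apply: wC].
Qed.

Lemma final_set_min (S A : {set cell}) : S \subset A -> rule_closed A -> final_set S \subset A.
Proof. by move=> sSA clA; apply: bigcap_inf; rewrite sSA clA. Qed.

Lemma contaminating_setT : contaminating [set: cell].
Proof. by rewrite /contaminating eqEsubset subsetT sub_final_set. Qed.

Lemma gamma_cP :
  (exists2 S : {set cell}, contaminating S & #|S| = gamma_c) /\
  (forall S : {set cell}, contaminating S -> gamma_c <= #|S|).
Proof.
rewrite /gamma_c; case: arg_minnP => [|S cS minS].
  exact: contaminating_setT.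
by split; first exists S.
Qed.

End Grid.

(* Main.v *)
(** In a single row a set is contaminating iff it contains both end cells and
    meets every pair of adjacent cells. Write the length as [2k + 1 + b] with
    [b] a boolean, and split the row into the cell 0, the pairs
    [(2i + 1, 2i + 2)] for [i < k] and, if [b] holds, the last cell: at least
    [k + 1 + b] cells are needed, and an optimal set picks exactly one cell of
    each pair. It follows that it takes the even cells up to some [2j <= 2k]
    and the odd cells after it; if the length is odd, the last cell [2k] forces
    [j = k], and otherwise each of the [k + 1] values of [j] is possible. *)
Require Import Defs.
From mathcomp Require Import all_boot.
From mathcomp Require Import zify.

Set Implicit Arguments.
Unset Strict Implicit.
Unset Printing Implicit Defensive.

Section Row.

Variable n : nat.

Implicit Types S : {set 'I_1 * 'I_n.+1}.

(* Outside of the row, i.e. for [x > n], [inord x] is [ord0]. *)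
Definition row_mem S (x : nat) : bool := (ord0, inord x) \in S.

Lemma row_memE S (u : 'I_1 * 'I_n.+1) : (u \in S) = row_mem S u.2.
Proof. by case: u => i x; rewrite /row_mem /= inord_val (ord1 i). Qed.

Lemma row_mem_set (p : pred nat) (x : nat) : x <= n ->
  row_mem [set u : 'I_1 * 'I_n.+1 | p u.2] x = p x.
Proof. by move=> le_xn; rewrite /row_mem inE /= inordK. Qed.

Lemma eq_row S S' :
  (forall x, x <= n -> row_mem S x = row_mem S' x) -> S = S'.
Proof.
by move=> eqSS'; apply/setP => u; rewrite !row_memE eqSS' // -ltnS ltn_ord.
Qed.

Lemma card_row S : #|S| = \sum_(x < n.+1) row_mem S x.
Proof.
rewrite -sum1_card big_mkcond /=.
have ->: \sum_(u : 'I_1 * 'I_n.+1) (if u \in S then 1 else 0)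
       = \sum_(u : 'I_1 * 'I_n.+1) nat_of_bool (row_mem S u.2).
  by apply: eq_bigr => u _; rewrite row_memE; case: row_mem.
by rewrite -(pair_bigA _ (fun _ x => nat_of_bool (row_mem S (val x)))) /= big_ord1.
Qed.

(** All row indices coincide, so every rule involving a row shift is void and only rule (d)
    survives. *)
Lemma contaminated_by_row (u v w : 'I_1 * 'I_n.+1) :
  contaminated_by u v w =
  (v.2.+1 == u.2 :> nat) && (w.2 == u.2.+1 :> nat).
Proof.
case: u v w => [i x] [i' y] [i'' z]; rewrite (ord1 i) (ord1 i') (ord1 i'').
by rewrite /contaminated_by /rule_a /rule_b /rule_c /rule_d /rule_e /rule_f
  /rule_g /rule_h /= ?andbF ?orbF.
Qed.

(* The hypothesis on [p] says that the complement of [p] is closed. *)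
Lemma contaminating_meets S (p : pred nat) (x : nat) :
    contaminating S -> x <= n -> p x ->
    (forall y, y.+1 < n -> p y.+1 -> p y || p y.+2) ->
  exists2 y, y <= n & p y && row_mem S y.
Proof.
move=> /eqP cS le_xn px pN.
case: (pickP [pred u : 'I_1 * 'I_n.+1 | p u.2 && row_mem S u.2]) => [u|S'p].
  by exists (val u.2); rewrite // -ltnS ltn_ord.
(* If [S] misses [p], the complement of [p] is a closed set containing [S], hence the whole row,
   against [p x]. *)
have: final_set S \subset [set u : 'I_1 * 'I_n.+1 | ~~ p u.2].
  apply: final_set_min; first apply/subsetP => u.
    by rewrite inE row_memE => Su; move: (S'p u); rewrite /= Su andbT => ->.
  apply/rule_closedP => u v w; rewrite contaminated_by_row !inE.
  case/andP=> /eqP uE /eqP wE npv npw; apply/negP.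
  rewrite -uE => pu.
  have := ltn_ord w.2; rewrite wE -uE !ltnS => lt_vn.
  by have := pN _ lt_vn pu; rewrite (negPf npv) uE -wE (negPf npw).
rewrite cS => /subsetP/(_ (ord0, inord x)); rewrite !inE /= inordK //.
by rewrite px => /(_ isT).
Qed.

(** Necessity: the complements of an end cell and of two adjacent cells are closed. Sufficiency: a
    cell outside [S] is interior with both neighbours in [S], so one use of rule (d) reaches it. *)
Lemma contaminating_rowP S :
  contaminating S <->
  [/\ row_mem S 0, row_mem S n
    & forall x, x < n -> row_mem S x || row_mem S x.+1].
Proof.
split=> [cS | [S0 Sn Sadj]].
  split.
  - by have [] := @contaminating_meets S (fun y => y == 0) 0 cS => // y _ /andP[/eqP->].
  - have [||y lt_yn|y _ /andP[/eqP->] //] := @contaminating_meets S (fun y => y == n) n cS;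
      rewrite //=; lia.
  - move=> x lt_xn.
    have [|||y _] := @contaminating_meets S (fun y => (y == x) || (y == x.+1)) x cS; rewrite /=; try lia.
    by case/andP=> /orP[]/eqP-> ->; rewrite ?orbT.
rewrite /contaminating eqEsubset subsetT; apply/subsetP => u _.
have [Su|S'u] := boolP (u \in S); first exact: (subsetP (sub_final_set S)).
have:= S'u; rewrite row_memE => S'x.
have le_un : u.2 <= n by rewrite -ltnS ltn_ord.
have u_gt0 : 0 < u.2 by rewrite lt0n; apply: contraNneq S'x => ->.
have lt_un : u.2 < n.
  by rewrite ltn_neqAle le_un andbT; apply: contraNneq S'x => ->.
have SN y : row_mem S y -> (ord0, inord y) \in final_set S.
  exact: (subsetP (sub_final_set S)).
have /rule_closedP cl := final_set_closed S.
apply: (cl u (ord0, inord u.2.-1) (ord0, inord u.2.+1)).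
- by rewrite contaminated_by_row /= !inordK ?prednK ?eqxx // leqW.
- by apply: SN; have := Sadj u.2.-1; rewrite prednK // (negPf S'x) orbF; apply.
- by apply: SN; have := Sadj _ lt_un; rewrite (negPf S'x).
Qed.

Definition even_then_odd (j : nat) : {set 'I_1 * 'I_n.+1} :=
  [set u : 'I_1 * 'I_n.+1 | odd u.2 == (j.*2 < u.2)].

Lemma row_mem_even_then_odd (j x : nat) : x <= n ->
  row_mem (even_then_odd j) x = (odd x == (j.*2 < x)).
Proof. exact: (row_mem_set (fun x => odd x == (j.*2 < x))). Qed.

Lemma even_then_odd_inj (i j : nat) : i.*2 <= n -> j.*2 <= n ->
  even_then_odd i = even_then_odd j -> i = j.
Proof.
move=> le_in le_jn eq_ij.
have eq_row x : row_mem (even_then_odd i) x = row_mem (even_then_odd j) x.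
  by rewrite eq_ij.
(* If [i < j], the even cell [2j] belongs to the set of [j] but not to that of [i]. *)
have := eq_row i.*2; have := eq_row j.*2.
by rewrite !row_mem_even_then_odd // !odd_double; lia.
Qed.

End Row.

Lemma sum_ord_pairs (f : nat -> nat) (k : nat) :
  \sum_(x < k.*2.+1) f x = f 0 + \sum_(i < k) (f i.*2.+1 + f i.*2.+2).
Proof.
elim: k => [|k IHk]; first by rewrite big_ord1 big_ord0 addn0.
by rewrite doubleS 2!big_ord_recr /= IHk big_ord_recr /= !addnA.
Qed.

Lemma leqif_sum_pos (k : nat) (f : nat -> nat) :
    (forall i, i < k -> 0 < f i) ->
  k <= \sum_(i < k) f i ?= iff [forall i : 'I_k, f i == 1].
Proof.
move=> f_gt0; have := leqif_sum (fun (i : 'I_k) (_ : true) =>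
  conj (f_gt0 i (ltn_ord i)) (erefl (1 == f i))).
rewrite sum1_card card_ord => -[le_k eq_k]; split=> //; rewrite eq_k.
by apply: eq_forallb => i; rewrite eq_sym.
Qed.

(** Used with [e i] saying that cell [2i] is chosen; [j] then marks the switch from even to odd
    cells. *)
Lemma downset_nat (k : nat) (e : pred nat) :
    e 0 -> (forall i, i < k -> e i.+1 -> e i) ->
  exists2 j, j <= k & forall i, i <= k -> e i = (i <= j).
Proof.
move=> e0; elim: k => [|k IHk] eS.
  by exists 0 => // i; rewrite leqn0 => /eqP->.
have [|j le_jk eE] := IHk; first by move=> i lt_ik; apply: eS; lia.
have [ek|e'k] := boolP (e k.+1).
  have le_kj : k <= j by rewrite -eE // eS.
  exists k.+1 => // i le_ik; rewrite le_ik; move: le_ik.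
  by rewrite leq_eqVlt => /predU1P[->|lt_ik] //; rewrite eE //; lia.
exists j => [|i le_ik]; first exact: leqW.
have [->|/eqP ne_ik] := eqVneq i k.+1; first by rewrite (negPf e'k); lia.
by rewrite eE //; lia.
Qed.

Section Optimal.

Variables (k : nat) (b : bool).

Let n := k.*2 + b.

Implicit Type S : {set 'I_1 * 'I_n.+1}.

Let pair_sum S (i : nat) : nat := row_mem S i.*2.+1 + row_mem S i.*2.+2.

Lemma card_contaminating S : contaminating S ->
  #|S| = 1 + b + \sum_(i < k) pair_sum S i.
Proof.
case/contaminating_rowP=> S0 Sn _; rewrite card_row.
(* If [b] holds, the extra term is the last cell, which is always chosen. *)
have ->: \sum_(x < n.+1) row_mem S x = \sum_(x < k.*2.+1) row_mem S x + b.
  move: (row_mem S) Sn => f; rewrite /n; case: (b); last by rewrite !addn0.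
  by rewrite addn1 => fn; rewrite big_ord_recr /= fn.
by rewrite (sum_ord_pairs (fun x => row_mem S x)) S0 addnAC.
Qed.

Lemma pair_sum_gt0 S (i : nat) : contaminating S -> i < k -> 0 < pair_sum S i.
Proof.
case/contaminating_rowP=> _ _ Sadj lt_ik.
have := Sadj i.*2.+1; rewrite /pair_sum /n.
by case: row_mem => //; case: row_mem => //; lia.
Qed.

Lemma card_contaminating_leqif S : contaminating S ->
  k.+1 + b <= #|S| ?= iff [forall i : 'I_k, pair_sum S i == 1].
Proof.
move=> cS; rewrite (card_contaminating cS).
have [le_k <-] := leqif_sum_pos (fun i => @pair_sum_gt0 S i cS).
by split; lia.
Qed.

(** Adjacent cells have opposite parities, and at the switch both [2j] and [2j + 1] are chosen. The
    last cell is odd if [b] holds; otherwise it is [2k], chosen only for [j = k]. *)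
Lemma contaminating_even_then_odd (j : nat) : j <= k -> b || (j == k) ->
  contaminating (even_then_odd n j).
Proof.
move=> le_jk j_last.
apply/contaminating_rowP; split=> [||x lt_xn]; rewrite !row_mem_even_then_odd //.
- by move: j_last; rewrite /n; case: (b) => [_|/eqP->]; rewrite oddD odd_double /=; lia.
- by lia.
- exact: ltnW.
Qed.

Lemma card_even_then_odd (j : nat) : j <= k -> b || (j == k) ->
  #|even_then_odd n j| = k.+1 + b.
Proof.
move=> le_jk j_last; apply/esym/eqP.
rewrite (card_contaminating_leqif (contaminating_even_then_odd le_jk j_last)).
apply/forallP=> i; have lt_ik := ltn_ord i.
(* The pair contributes its even cell if [i < j] and its odd cell otherwise. *)
by rewrite /pair_sum !row_mem_even_then_odd /n /= ?odd_double; lia.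
Qed.

Lemma gamma_c_row : gamma_c 1 n.+1 = k.+1 + b.
Proof.
have [[S cS <-] min_gamma] := gamma_cP 1 n.+1.
have k_last : b || (k == k) by rewrite eqxx orbT.
have := min_gamma _ (contaminating_even_then_odd (leqnn k) k_last).
rewrite (card_even_then_odd (leqnn k) k_last) => le_gamma.
by apply/eqP; rewrite eqn_leq (card_contaminating_leqif cS) andbT.
Qed.

Lemma optimal_rowP S :
  optimal S <->
  exists2 j, (j <= k) && (b || (j == k)) & S = even_then_odd n j.
Proof.
split=> [/andP[cS]|[j /andP[le_jk j_last] ->]]; last first.
  by rewrite /optimal contaminating_even_then_odd // card_even_then_odd //
    gamma_c_row eqxx.
rewrite gamma_c_row eq_sym (card_contaminating_leqif cS) => /forallP pair1.
have oddE i : i < k -> row_mem S i.*2.+1 = ~~ row_mem S i.*2.+2.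
  move=> lt_ik; have := pair1 (Ordinal lt_ik); rewrite /pair_sum /=.
  by do 2!case: row_mem.
have [S0 Sn Sadj] := (contaminating_rowP S).1 cS.
(* If cell [2i + 2] is chosen, [2i + 1] is not, and adjacency forces cell [2i]. *)
have [||j le_jk evenE] := @downset_nat k (fun i => row_mem S i.*2) => //.
  case=> // i lt_ik Si; have := Sadj i.*2.+2.
  by rewrite -doubleS oddE // Si orbF; apply; rewrite /n; lia.
exists j.
  rewrite le_jk; apply: contraT => /norP[b' neq_jk].
  have nE : n = k.*2 by rewrite /n (negPf b') addn0.
  by have := evenE k (leqnn k); rewrite -nE Sn; lia.
apply: eq_row => x le_xn; rewrite row_mem_even_then_odd //.
have [i [xE|xE]] : exists i, x = i.*2 \/ x = i.*2.+1 by exists x./2; lia.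
  by rewrite xE evenE; rewrite /n in le_xn; lia.
have [lt_ik|le_ki] := ltnP i k; first by rewrite xE oddE // -doubleS evenE //; lia.
(* An odd cell outside all pairs can only be the last one, with [b] true. *)
have nE : x = n by rewrite /n in le_xn *; lia.
by rewrite nE Sn -nE xE /=; lia.
Qed.

End Optimal.

Theorem proposition5 (m : nat) (hm : 1 <= m) :
  alpha 1 m = if odd m then 1 else m %/ 2.
Proof.
(* Here [b] is [~~ odd m]: an even length leaves one cell after the pairs. *)
pose k := m.-1./2; have mE : m = (k.*2 + ~~ odd m).+1 by rewrite /k; lia.
rewrite {1}mE /alpha; case: ifP mE => _ mE.
  rewrite -[~~ true]/false.
  apply: etrans (cards1 (even_then_odd (k.*2 + false) k)); apply: eq_card => S.
  rewrite !inE; apply/idP/eqP => [/optimal_rowP[j /andP[_ /eqP->]] // |->].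
  by apply/optimal_rowP; exists k; rewrite ?leqnn ?eqxx.
rewrite -[~~ false]/true.
have inj : injective (fun j : 'I_k.+1 => even_then_odd (k.*2 + true) j).
  move=> i j /even_then_odd_inj eq_ij; apply: val_inj; apply: eq_ij;
    have := ltn_ord i; have := ltn_ord j; lia.
have -> : m %/ 2 = #|'I_k.+1| by rewrite card_ord; lia.
rewrite -(card_imset _ inj); apply: eq_card => S; rewrite inE.
apply/idP/imsetP => [/optimal_rowP[j /andP[le_jk _] ->]|[j _ ->]].
  by exists (Ordinal (le_jk : j < k.+1)).
by apply/optimal_rowP; exists (val j); rewrite //= -ltnS ltn_ord.
Qed.
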